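(* Let $0<r<1$, $y=\frac{\sqrt3}{6}$, and let $Q_1$ be a point on side $AB$ of the unit equilateral triangle $ABC$ such that the points $J_1,P_1,Z$ described in the context exist. Put $$t_1=y+0.5+|BQ_1|+|Q_1C|,$$ $$t_2=y+0.5+|BQ_1|+|Q_1J_1|+|J_1P_1|+|P_1Q_1|+|Q_1Z|+|ZQ_2|.$$ Then the worst-case evacuation time of the 1-Detour algorithm (with this choice of $Q_1$) for two agents with communication range $r$ is $$E_{\text{1-Detour}}(2,r)=\max\{t_1,t_2\}.$$
   Context: Setting. $T$ is an equilateral triangle with vertices $A,B,C$ and sides of length $1$, $O$ is its centroid, $M$ is the midpoint of $BC$, and $y=\frac{\sqrt3}{6}=|OM|$. A single exit lies at a point of the perimeter of $T$ unknown to the agents. Two agents $R_1,R_2$ start at $O$ at time $0$ and move at speed $1$. An agent recognizes the exit only when it is at the exit's location. The two agents can instantly exchange information exactly when their distance is at most $r$. The evacuation time for a given exit is the first time by which both agents have reached the exit. Generic two-agent algorithm. Each agent moves at unit speed along its predetermined trajectory until it finds the exit or receives a message with the exit's location. If an agent finds the exit at a point $P$ at time $t_P$: if the other agent is within distance $r$, it sends $P$ at once; otherwise it moves in a straight line to the closest point $U$ at which the other agent (still following its own trajectory) can be $r$-intercepted, i.e. so as to come within distance $r$ of the other agent as early as possible (the other agent is then at the first point $Q$ of its trajectory, reached at time $\tau\ge t_P$, with $|PQ|-r\le \tau-t_P$), and sends $P$. After that both agents go straight to $P$. 1-Detour algorithm. Fix $Q_1$ on side $AB$ with $|AQ_1|>r$;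 let $Q_2$ be its mirror image in line $AM$ (so $Q_2\in AC$). $J_1$ is the point of segment $Q_1C$ with $|BQ_1|+|Q_1J_1|=|CJ_1|-r$. $P_1$ is the point of segment $J_1Q_2$ with $|Q_1J_1|+|J_1P_1|=|Q_2P_1|-r$. $J_2,P_2$ are the mirror images of $J_1,P_1$ in line $AM$. $R_1$ follows $\langle O,M,B,Q_1,J_1,P_1,Q_1,A\rangle$ and $R_2$ follows $\langle O,M,C,Q_2,J_2,P_2,Q_2,A\rangle$; the generic algorithm is run with these trajectories. $Z$ is the point of segment $Q_1A$ with $|Q_1Z|+r=|Q_2Z|$ (if the exit is located right after $Q_2$ on $Q_2A$, then $R_1$ is $r$-intercepted at or before $Z$). $E_{\text{1-Detour}}(2,r)$ is the supremum, over all exit locations on the perimeter of $T$, of the evacuation time of this algorithm. *)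

(* Defs.v *)
From Stdlib Require Import Reals List.
From Coquelicot Require Import Coquelicot.
Import ListNotations.
Open Scope R_scope.

(** The Euclidean plane is Coquelicot's complex plane.  The alias [point] leaves
    the letter [C] free for the third vertex of the triangle. *)
Definition point : Type := C.

Definition cdist (P Q : point) : R := Cmod (Q - P)%C.

Definition on_segment (P Q X : point) : Prop :=
  exists s : R, 0 <= s <= 1 /\ X = (P + RtoC s * (Q - P))%C.

Definition on_perimeter (A B C X : point) : Prop :=
  on_segment A B X \/ on_segment B C X \/ on_segment C A X.

Definition midpoint (P Q : point) : point := ((P + Q) / RtoC 2)%C.

Definition centroid (A B C : point) : point := ((A + B + C) / RtoC 3)%C.

(** Mirror image of [X] in the line through the distinct points [P] and [Q]:
    conjugation, in the complex coordinate sending [P] to 0 and [Q] to 1. *)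
Definition mirror (P Q X : point) : point :=
  (P + (Q - P) * Cconj ((X - P) / (Q - P)))%C.

(** Position after travelling a distance [s >= 0] from [P] straight towards [Q],
    stopping at [Q]. *)
Definition walk (P Q : point) (s : R) : point :=
  if Rle_dec (cdist P Q) s then Q
  else (P + RtoC (s / cdist P Q) * (Q - P))%C.

(** Position at time [t >= 0] on the unit-speed polygonal trajectory starting
    at [P] and visiting the listed points in order; it rests at the last one. *)
Fixpoint polyline (P : point) (l : list point) (t : R) : point :=
  match l with
  | [] => P
  | Q :: l' => if Rle_dec t (cdist P Q) then walk P Q t
               else polyline Q l' (t - cdist P Q)
  end.

Definition is_first (S : R -> Prop) (t : R) : Prop :=
  S t /\ forall s : R, S s -> t <= s.

(** The agent with predetermined trajectory [X] is the one that finds the exit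
    [P], at time [tP], and [tau] is the time at which the agent with trajectory
    [Y] receives the message.  If [Y] is within distance [r] of [P] at time [tP],
    then [tau = tP]. *)
Definition message_times (r : R) (X Y : R -> point) (P : point) (tP tau : R)
  : Prop :=
  is_first (fun t => 0 <= t /\ (X t = P \/ Y t = P)) tP /\
  X tP = P /\
  is_first (fun t => tP <= t /\ cdist P (Y t) - r <= t - tP) tau.

(** The point from which the finder sends its message: the point nearest to [P]
    of the segment from [P] to [Q = Y tau] that is within distance [r] of [Q]. *)
Definition send_point (r : R) (Y : R -> point) (P : point) (tau : R) : point :=
  walk P (Y tau) (Rmax 0 (cdist P (Y tau) - r)).

Definition finder_position (r : R) (X Y : R -> point) (P : point) (tP tau t : R)
  : point :=
  let U := send_point r Y P tau in
  if Rle_dec t tP then X t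
  else if Rle_dec t tau then walk P U (t - tP)
  else walk U P (t - tau).

Definition receiver_position (Y : R -> point) (P : point) (tau t : R) : point :=
  if Rle_dec t tau then Y t else walk (Y tau) P (t - tau).

Definition reached_by (F : R -> point) (P : point) (t : R) : Prop :=
  exists s : R, 0 <= s <= t /\ F s = P.

Definition both_reached_by (r : R) (X Y : R -> point) (P : point) (t : R)
  : Prop :=
  exists tP tau : R,
    message_times r X Y P tP tau /\
    reached_by (finder_position r X Y P tP tau) P t /\
    reached_by (receiver_position Y P tau) P t.

(** Evacuation time of the generic algorithm run with trajectories [X1] and [X2]
    for the exit [P] (either agent may be the finder); it is [p_infty] if the
    evacuation never completes. *)
Definition evacuation_time (r : R) (X1 X2 : R -> point) (P : point) : Rbar :=
  Glb_Rbar (fun t => both_reached_by r X1 X2 P t \/ both_reached_by r X2 X1 P t).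

Definition worst_case_evacuation_time (r : R) (X1 X2 : R -> point)
  (exits : point -> Prop) : Rbar :=
  Rbar_lub (fun e => exists P : point, exits P /\ e = evacuation_time r X1 X2 P).

Definition detour_trajectory (A B C V Q J P : point) : R -> point :=
  polyline (centroid A B C) [midpoint B C; V; Q; J; P; Q; A].

Definition E_1Detour (r : R) (A B C Q1 J1 P1 : point) : Rbar :=
  let sym := mirror A (midpoint B C) in
  worst_case_evacuation_time r
    (detour_trajectory A B C B Q1 J1 P1)
    (detour_trajectory A B C C (sym Q1) (sym J1) (sym P1))
    (on_perimeter A B C).

(* Main.v *)
Require Import Defs.
From Stdlib Require Import Reals.
From Coquelicot Require Import Coquelicot.
From Stdlib Require Import List Lra.
Import ListNotations.
Open Scope R_scope.

(** An agent that found the exit [P] at time [tP] meets the other agent, moving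
    along [Y], at the first time [tau] with [|P (Y tau)| - r <= tau - tP]; then
    the evacuation ends at [tau + |P (Y tau)|], which is nondecreasing in [tau]
    because [Y] has unit speed.  So any time satisfying the inequality gives an
    upper bound.  By convexity of distance, such a time for the exits on a
    segment is obtained by interpolating affinely between its two ends:
    meeting point [J2] for exits on [MB], from [J2] to [P2] for exits from [B] to
    [Q1], from the mirror image of [Z] to [A] for exits from [Q1] to [A].  The
    value [t1] is attained at the exit [B], and [t2] is the limit at exits on
    [Q1 A] tending to [Q1] (the exit [Q1] itself is found before the detour). *)

(** * Distances and polygonal trajectories *)

(** Parametrised by the fraction [l] of the way, where [walk] uses arc length. Being affine in [l],
    it gives access to convexity. *)
Definition towards (P Q : point) (l : R) : point := (P + RtoC l * (Q - P))%C.

Lemma towards_0 (P Q : point) : towards P Q 0 = P.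
Proof. unfold towards; apply injective_projections; simpl; ring. Qed.

Lemma towards_1 (P Q : point) : towards P Q 1 = Q.
Proof. unfold towards; apply injective_projections; simpl; ring. Qed.

Lemma towards_self (P : point) (l : R) : towards P P l = P.
Proof. unfold towards; apply injective_projections; simpl; ring. Qed.

Lemma cdist_ge_0 (P Q : point) : 0 <= cdist P Q.
Proof. apply Cmod_ge_0. Qed.

Lemma cdist_sym (P Q : point) : cdist P Q = cdist Q P.
Proof.
  unfold cdist; rewrite <- Cmod_opp; f_equal.
  apply injective_projections; simpl; ring.
Qed.

Lemma cdist_triangle (P Q S : point) : cdist P S <= cdist P Q + cdist Q S.
Proof.
  unfold cdist; eapply Rle_trans; [| apply Cmod_triangle].
  apply Req_le; f_equal; apply injective_projections; simpl; ring.
Qed.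

Lemma cdist_eq_0 (P Q : point) : cdist P Q = 0 -> P = Q.
Proof.
  intros H; apply Cmod_eq_0 in H.
  destruct P as [p p'], Q as [q q']; injection H as H1 H2; simpl in *.
  f_equal; lra.
Qed.

Lemma cdist_refl (P : point) : cdist P P = 0.
Proof.
  unfold cdist; replace (P - P)%C with (RtoC 0) by (apply injective_projections; simpl; ring).
  apply Cmod_0.
Qed.

Lemma cdist_towards (P Q : point) (l l' : R) :
  cdist (towards P Q l) (towards P Q l') = Rabs (l' - l) * cdist P Q.
Proof.
  unfold cdist, towards; rewrite <- Cmod_R, <- Cmod_mult; f_equal.
  apply injective_projections; simpl; ring.
Qed.

Lemma cdist_towards_l (P Q : point) (l : R) :
  0 <= l -> cdist P (towards P Q l) = l * cdist P Q.
Proof.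
  intros Hl; rewrite <- (towards_0 P Q) at 1; rewrite cdist_towards, Rminus_0_r, Rabs_pos_eq; auto.
Qed.

Lemma cdist_towards_r (P Q : point) (l : R) :
  l <= 1 -> cdist (towards P Q l) Q = (1 - l) * cdist P Q.
Proof.
  intros Hl; rewrite <- (towards_1 P Q) at 2; rewrite cdist_towards, Rabs_pos_eq; auto; lra.
Qed.

Lemma cdist_convex (P P' K K' : point) (l : R) :
  0 <= l <= 1 ->
  cdist (towards P P' l) (towards K K' l) <= (1 - l) * cdist P K + l * cdist P' K'.
Proof.
  intros Hl; unfold cdist, towards.
  replace (_ - _)%C with (RtoC (1 - l) * (K - P) + RtoC l * (K' - P'))%C
    by (apply injective_projections; simpl; ring).
  eapply Rle_trans; [apply Cmod_triangle |].
  rewrite !Cmod_mult, !Cmod_R, !Rabs_pos_eq by lra; lra.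
Qed.

Lemma walk_towards (P Q : point) (l : R) :
  0 <= l <= 1 -> walk P Q (l * cdist P Q) = towards P Q l.
Proof.
  intros Hl; unfold walk; pose proof (cdist_ge_0 P Q) as Hd.
  destruct (Rle_dec (cdist P Q) (l * cdist P Q)) as [H | H].
  - destruct (Req_dec (cdist P Q) 0) as [E | E].
    + apply cdist_eq_0 in E; subst; now rewrite towards_self.
    + replace l with 1 by nra; now rewrite towards_1.
  - unfold towards; do 3 f_equal; field; nra.
Qed.

Lemma walk_arrival (P Q : point) (s : R) :
  0 <= s -> walk P Q s = Q -> cdist P Q <= s.
Proof.
  intros Hs; unfold walk; destruct (Rle_dec (cdist P Q) s) as [H | H]; auto.
  intros E; exfalso; apply Rnot_le_lt in H.
  assert (Hl : s / cdist P Q < 1) by (apply Rlt_div_l; lra).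
  pose proof (cdist_towards_r P Q (s / cdist P Q) (Rlt_le _ _ Hl)) as D.
  unfold towards in D; rewrite E, cdist_refl in D; nra.
Qed.

Lemma polyline_0 (P : point) (L : list point) : polyline P L 0 = P.
Proof.
  destruct L as [| Q L]; auto; simpl.
  destruct (Rle_dec 0 (cdist P Q)) as [H | H].
  - rewrite <- (Rmult_0_l (cdist P Q)), walk_towards by lra; apply towards_0.
  - now pose proof (cdist_ge_0 P Q).
Qed.

Lemma polyline_leg (P Q : point) (L : list point) (d l : R) :
  cdist P Q = d -> 0 <= l <= 1 -> polyline P (Q :: L) (l * d) = towards P Q l.
Proof.
  intros <- Hl; simpl; pose proof (cdist_ge_0 P Q).
  destruct (Rle_dec (l * cdist P Q) (cdist P Q)); [now apply walk_towards | nra].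
Qed.

Lemma polyline_skip (P Q : point) (L : list point) (d s : R) :
  cdist P Q = d -> 0 <= s -> polyline P (Q :: L) (d + s) = polyline Q L s.
Proof.
  intros <- Hs; simpl; destruct (Rle_dec (cdist P Q + s) (cdist P Q)).
  - replace s with 0 by lra; rewrite polyline_0.
    replace (cdist P Q + 0) with (1 * cdist P Q) by ring.
    rewrite walk_towards by lra; apply towards_1.
  - f_equal; ring.
Qed.

Lemma polyline_inv (P Q : point) (L : list point) (t : R) :
  0 <= t ->
  (exists l, 0 <= l <= 1 /\ t = l * cdist P Q /\ polyline P (Q :: L) t = towards P Q l) \/
  (exists s, 0 < s /\ t = cdist P Q + s /\ polyline P (Q :: L) t = polyline Q L s).
Proof.
  intros Ht; destruct (Rle_lt_dec t (cdist P Q)) as [H | H].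
  - left; destruct (Req_dec (cdist P Q) 0) as [E | E].
    + exists 0; replace t with (0 * cdist P Q) by lra.
      repeat split; try lra; apply polyline_leg; auto; lra.
    + exists (t / cdist P Q); pose proof (cdist_ge_0 P Q).
      assert (Hl : 0 <= t / cdist P Q <= 1).
      { split; [apply Rdiv_le_0_compat | apply Rle_div_l]; lra. }
      assert (Et : t = t / cdist P Q * cdist P Q) by (field; lra).
      repeat split; try lra; rewrite Et at 1; now apply polyline_leg.
  - right; exists (t - cdist P Q); repeat split; try lra.
    replace t with (cdist P Q + (t - cdist P Q)) at 1 by ring.
    apply polyline_skip; auto; lra.
Qed.

Definition speed_le_1 (Y : R -> point) : Prop :=
  forall s t, 0 <= s <= t -> cdist (Y s) (Y t) <= t - s.

Lemma polyline_speed (P : point) (L : list point) : speed_le_1 (polyline P L).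
Proof.
  revert P; induction L as [| Q L IH]; intros P s t Hst.
  - simpl; rewrite cdist_refl; lra.
  - pose proof (cdist_ge_0 P Q).
    destruct (polyline_inv P Q L s) as [(l & Hl & Es & ->) | (s' & Hs & Es & ->)]; [lra | |];
    (destruct (polyline_inv P Q L t) as [(l' & Hl' & Et & ->) | (t' & Ht & Et & ->)]; [lra | |]).
    + rewrite cdist_towards; destruct (Rle_lt_dec l l').
      * rewrite Rabs_pos_eq; lra.
      * rewrite Rabs_left; nra.
    + pose proof (cdist_triangle (towards P Q l) Q (polyline Q L t')) as D.
      rewrite cdist_towards_r in D by lra.
      pose proof (IH Q 0 t'); rewrite polyline_0 in *; lra.
    (* Here [s] lies past the first leg and [t] on it, against [s <= t]. *)
    + nra.
    + specialize (IH Q s' t'); lra.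
Qed.

(** * Evacuation time of a single exit *)

(** [Y] may be at [P] at time [t] as well: both agents reach the exit M together. *)
Definition first_visit (X Y : R -> point) (P : point) (t : R) : Prop :=
  0 <= t /\ X t = P /\ forall s, 0 <= s < t -> X s <> P /\ Y s <> P.

Lemma evacuation_time_sym (r : R) (X Y : R -> point) (P : point) :
  evacuation_time r X Y P = evacuation_time r Y X P.
Proof. apply Glb_Rbar_eqset; intros t; tauto. Qed.

(** The infimum of the admissible times is attained because the condition is closed, [Y] being
    1-Lipschitz. *)
Lemma first_interception (r : R) (Y : R -> point) (P : point) (tP t' : R) :
  speed_le_1 Y -> 0 <= tP <= t' -> cdist P (Y t') - r <= t' - tP ->
  exists tau, tau <= t' /\
    is_first (fun t => tP <= t /\ cdist P (Y t) - r <= t - tP) tau.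
Proof.
  intros HY Ht' H.
  set (S := fun t => tP <= t /\ cdist P (Y t) - r <= t - tP).
  (* [completeness] yields suprema, so the infimum is minus the supremum of the negated times. *)
  destruct (completeness (fun u => S (- u))) as [u [Hu1 Hu2]].
  { exists (- tP); intros u [Hu _]; lra. }
  { exists (- t'); unfold S; rewrite Ropp_involutive; split; [lra | exact H]. }
  exists (- u).
  assert (Hlow : forall s, S s -> - u <= s).
  { intros s Hs; enough (- s <= u) by lra; apply Hu1; now rewrite Ropp_involutive. }
  assert (HtP : tP <= - u).
  { enough (u <= - tP) by lra; apply Hu2; intros v [Hv _]; lra. }
  split; [apply Hlow; split; [lra | exact H] |].
  split; [| exact Hlow]; split; auto.
  (* Going back to [- u] from an admissible [s] within [eps / 2] of it changes each side of the
     inequality by less than [eps / 2]. *)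
  apply le_epsilon; intros eps Heps.
  destruct (Classical_Prop.classic (exists s, S s /\ s < - u + eps / 2)) as [(s & Hs & Hse) | N].
  - pose proof (Hlow s Hs); destruct Hs as [Hs1 Hs2].
    pose proof (cdist_triangle P (Y s) (Y (- u))) as D.
    rewrite (cdist_sym (Y s)) in D.
    pose proof (HY (- u) s); lra.
  - exfalso; enough (u <= u - eps / 2) by lra.
    apply Hu2; intros v Hv; apply Rnot_lt_le; intros L; apply N.
    exists (- v); split; [exact Hv | lra].
Qed.

Lemma evacuation_time_le (r : R) (X Y : R -> point) (P : point) (tP t' : R) :
  speed_le_1 Y -> first_visit X Y P tP ->
  tP <= t' -> cdist P (Y t') - r <= t' - tP ->
  Rbar_le (evacuation_time r X Y P) (t' + cdist P (Y t')).
Proof.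
  intros HY (HtP & HX & Hfirst) Ht' H.
  destruct (first_interception r Y P tP t') as (tau & Htau & HT); auto.
  apply Rbar_le_trans with (tau + cdist P (Y tau)).
  - apply (Glb_Rbar_correct (fun t => both_reached_by r X Y P t \/ both_reached_by r Y X P t)).
    left; exists tP, tau.
    pose proof (cdist_ge_0 P (Y tau)); assert (tP <= tau) by apply HT.
    repeat split; auto; try apply HT.
    + intros s [Hs HsP]; apply Rnot_lt_le; intros L.
      destruct (Hfirst s); tauto.
    (* The finder counts as arrived from [tP] on; the receiver's walk decides the end. *)
    + exists tP; split; [lra |].
      unfold finder_position; destruct (Rle_dec tP tP); [auto | lra].
    + exists (tau + cdist P (Y tau)); split; [lra |].
      unfold receiver_position; destruct (Rle_dec (tau + cdist P (Y tau)) tau).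
      * assert (E : cdist P (Y tau) = 0) by lra; rewrite E, Rplus_0_r.
        now apply cdist_eq_0 in E.
      * rewrite cdist_sym; replace (tau + cdist (Y tau) P - tau) with (1 * cdist (Y tau) P) by ring.
        rewrite walk_towards by lra; apply towards_1.
  - simpl; pose proof (cdist_triangle P (Y t') (Y tau)) as D.
    rewrite (cdist_sym (Y t')) in D.
    assert (tP <= tau) by apply HT; pose proof (HY tau t'); lra.
Qed.

(** Without interception before [t'], the message arrives at some [tau >= t'], and
    [tau + cdist P (Y tau)] is nondecreasing in [tau]. The condition [Y tP <> P] excludes [Y] as
    finder. *)
Lemma evacuation_time_ge (r : R) (X Y : R -> point) (P : point) (tP t' : R) :
  0 < r -> speed_le_1 Y -> first_visit X Y P tP -> Y tP <> P -> tP <= t' ->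
  (forall s, tP <= s < t' -> s - tP < cdist P (Y s) - r) ->
  Rbar_le (t' + cdist P (Y t')) (evacuation_time r X Y P).
Proof.
  intros Hr HY (HtP & HX & Hfirst) HYP Ht' H.
  apply (Glb_Rbar_correct (fun t => both_reached_by r X Y P t \/ both_reached_by r Y X P t)).
  assert (Huniq : forall u,
    is_first (fun t => 0 <= t /\ (X t = P \/ Y t = P)) u -> u = tP).
  { intros u [[Hu0 HuP] Hu]; assert (u <= tP) by (apply Hu; auto).
    destruct (Rle_lt_dec tP u); [lra |]; destruct (Hfirst u); [lra | tauto]. }
  intros t [(u & tau & (Hu & _ & Htau) & _ & (s & Hs & HsP))
           | (u & tau & (Hu & HuP & _) & _)].
  2: { exfalso; apply HYP; rewrite <- HuP; f_equal; symmetry; apply Huniq.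
       destruct Hu as [[Hu0 HuP'] Hu]; split; [tauto |].
       intros v Hv; apply Hu; tauto. }
  apply Huniq in Hu; subst u.
  destruct Htau as [[HtPtau Hint] Htau].
  assert (Ht'tau : t' <= tau).
  { apply Rnot_lt_le; intros L; specialize (H tau); lra. }
  assert (Hmono : t' + cdist P (Y t') <= tau + cdist P (Y tau)).
  { pose proof (cdist_triangle P (Y tau) (Y t')) as D.
    rewrite (cdist_sym (Y tau)) in D; pose proof (HY t' tau); lra. }
  simpl; apply Rle_trans with (1 := Hmono).
  (* A receiver standing at [P] after [tP] satisfies the interception inequality, so it cannot
     arrive before [tau]. *)
  unfold receiver_position in HsP; destruct (Rle_dec s tau) as [L | L].
  - assert (tP <= s).
    { apply Rnot_lt_le; intros L'; destruct (Hfirst s); [lra | tauto]. }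
    assert (tau <= s) by (apply Htau; rewrite HsP, cdist_refl; lra).
    replace tau with s by lra; rewrite HsP, cdist_refl; lra.
  - apply walk_arrival in HsP; [rewrite cdist_sym; lra | lra].
Qed.

(* Distances are convex along a pair of affine motions, so a bound on the
   evacuation time that is valid for the exits at both ends of a chord is valid
   in between. *)
Lemma evacuation_time_le_chord (r : R) (X Y : R -> point) (P P' K K' : point)
    (s s' t t' l m : R) :
  speed_le_1 Y -> 0 <= l <= 1 ->
  first_visit X Y (towards P P' l) ((1 - l) * s + l * s') ->
  Y ((1 - l) * t + l * t') = towards K K' l ->
  s <= t -> s' <= t' ->
  cdist P K - r <= t - s -> cdist P' K' - r <= t' - s' ->
  t + cdist P K <= m -> t' + cdist P' K' <= m ->
  Rbar_le (evacuation_time r X Y (towards P P' l)) m.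
Proof.
  intros HY Hl HX EY Hst Hst' H H' Hm Hm'.
  pose proof (cdist_convex P P' K K' l Hl) as D.
  eapply Rbar_le_trans.
  - apply (evacuation_time_le r X Y _ _ ((1 - l) * t + l * t') HY HX); [nra |].
    rewrite EY; nra.
  - rewrite EY; simpl; nra.
Qed.

(** * The two mirror-image detour routes *)

Definition equilateral (A B C : point) : Prop :=
  cdist A B = 1 /\ cdist B C = 1 /\ cdist C A = 1.

(** Affine coordinates with origin [A], in which [B] is (1,0) and [C] is (0,1). Exchanging [B] and
    [C] is the reflection in AM and swaps the coordinates, so the second agent follows
    [route A C B]. *)
Definition bary (A B C : point) (b g : R) : point :=
  (A + RtoC b * (B - A) + RtoC g * (C - A))%C.

(* The cross term has coefficient 1 because the unit vectors [B - A] and [C - A]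
   have inner product 1/2. *)
Definition bary_dist (b g b' g' : R) : R :=
  sqrt ((b' - b) ^ 2 + (b' - b) * (g' - g) + (g' - g) ^ 2).

Lemma equilateral_swap (A B C : point) : equilateral A B C -> equilateral A C B.
Proof.
  intros (H1 & H2 & H3); unfold equilateral.
  now rewrite (cdist_sym A C), (cdist_sym C B), (cdist_sym B A).
Qed.

Lemma bary_swap (A B C : point) (b g : R) : bary A C B b g = bary A B C g b.
Proof. unfold bary; apply injective_projections; simpl; ring. Qed.

Lemma bary_towards (A B C : point) (b g b' g' l : R) :
  towards (bary A B C b g) (bary A B C b' g') l
  = bary A B C (b + l * (b' - b)) (g + l * (g' - g)).
Proof. unfold towards, bary; apply injective_projections; simpl; ring. Qed.

Lemma cdist_sqr (P Q : point) :
  cdist P Q ^ 2 = (fst Q - fst P) ^ 2 + (snd Q - snd P) ^ 2.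
Proof.
  unfold cdist, Cmod; rewrite pow2_sqrt; [simpl; ring |].
  pose proof (pow2_ge_0 (fst (Q - P)%C)); pose proof (pow2_ge_0 (snd (Q - P)%C)); lra.
Qed.

Lemma cdist_bary (A B C : point) (b g b' g' : R) :
  equilateral A B C ->
  cdist (bary A B C b g) (bary A B C b' g') = bary_dist b g b' g'.
Proof.
  intros (HAB & HBC & HCA).
  unfold bary_dist; rewrite <- (sqrt_pow2 (cdist _ _)) by apply cdist_ge_0; f_equal.
  pose proof (cdist_sqr A B) as E1; pose proof (cdist_sqr B C) as E2; pose proof (cdist_sqr C A) as E3.
  rewrite HAB in E1; rewrite HBC in E2; rewrite HCA in E3; rewrite cdist_sqr; unfold bary.
  destruct A as [a1 a2], B as [b1 b2], C as [c1 c2]; simpl in *.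
  set (u1 := b1 - a1); set (u2 := b2 - a2); set (v1 := c1 - a1); set (v2 := c2 - a2).
  assert (H1 : u1 * u1 + u2 * u2 = 1) by (unfold u1, u2; lra).
  assert (H2 : v1 * v1 + v2 * v2 = 1) by (unfold v1, v2; lra).
  (* This is [|u - v| = |BC| = 1] expanded. *)
  assert (H3 : 2 * (u1 * v1 + u2 * v2) = 1) by (unfold u1, u2, v1, v2; lra).
  transitivity ((b' - b) ^ 2 * (u1 * u1 + u2 * u2)
    + (b' - b) * (g' - g) * (2 * (u1 * v1 + u2 * v2)) + (g' - g) ^ 2 * (v1 * v1 + v2 * v2)).
  - unfold u1, u2, v1, v2; ring.
  - rewrite H1, H2, H3; ring.
Qed.

Lemma bary_dist_form_ge_0 (u v : R) : 0 <= u ^ 2 + u * v + v ^ 2.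
Proof. pose proof (pow2_ge_0 (u + v / 2)); pose proof (pow2_ge_0 v); lra. Qed.

Lemma bary_dist_eq (b g b' g' d : R) :
  0 <= d -> (b' - b) ^ 2 + (b' - b) * (g' - g) + (g' - g) ^ 2 = d ^ 2 ->
  bary_dist b g b' g' = d.
Proof. intros Hd H; unfold bary_dist; rewrite H; now apply sqrt_pow2. Qed.

Lemma bary_dist_sqr (b g b' g' : R) :
  bary_dist b g b' g' ^ 2 = (b' - b) ^ 2 + (b' - b) * (g' - g) + (g' - g) ^ 2.
Proof. apply pow2_sqrt, bary_dist_form_ge_0. Qed.

Lemma bary_dist_ge_0 (b g b' g' : R) : 0 <= bary_dist b g b' g'.
Proof. apply sqrt_pos. Qed.

Lemma bary_dist_sym (b g b' g' : R) : bary_dist b g b' g' = bary_dist b' g' b g.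
Proof. unfold bary_dist; f_equal; ring. Qed.

Lemma bary_dist_swap (b g b' g' : R) : bary_dist b g b' g' = bary_dist g b g' b'.
Proof. unfold bary_dist; f_equal; ring. Qed.

Lemma bary_inj (A B C : point) (b g b' g' : R) :
  equilateral A B C -> bary A B C b g = bary A B C b' g' -> b = b' /\ g = g'.
Proof.
  intros ABC E.
  pose proof (cdist_bary A B C b g b' g' ABC) as D; rewrite E, cdist_refl in D.
  pose proof (bary_dist_sqr b g b' g') as S; rewrite <- D, pow_i in S by auto.
  assert (S' : ((b' - b) + (g' - g) / 2) ^ 2 + 3 / 4 * (g' - g) ^ 2 = 0)
    by (rewrite S; field).
  pose proof (pow2_ge_0 ((b' - b) + (g' - g) / 2)); pose proof (pow2_ge_0 (g' - g)).
  assert (Hg : Rsqr (g' - g) = 0) by (unfold Rsqr; lra).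
  assert (Hb : Rsqr ((b' - b) + (g' - g) / 2) = 0) by (unfold Rsqr; lra).
  apply Rsqr_eq_0 in Hg, Hb; lra.
Qed.

Lemma leg_parameter (d t : R) : 0 <= t <= d -> exists l, 0 <= l <= 1 /\ t = l * d.
Proof.
  intros Ht; destruct (Req_dec d 0) as [E | E].
  - exists 0; lra.
  - exists (t / d); split; [split; [apply Rdiv_le_0_compat | apply Rle_div_l]; lra | field; auto].
Qed.

(** * Positions along the detour route in affine coordinates *)

Section Route.

(** [a] is the distance |AQ1|; [j] and [m] are the fractions at which J1 divides Q1C and P1 divides
    J1Q2. Thus [turn1] is J1 and [turn2] is P1, and with [B] and [C] exchanged they are J2 and
    P2. *)
Variables a j m : R.
Hypothesis Ha : 0 < a <= 1.
Hypothesis Hj : 0 <= j <= 1.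
Hypothesis Hm : 0 <= m <= 1.

Definition turn1 (A B C : point) : point := bary A B C ((1 - j) * a) j.
Definition turn2 (A B C : point) : point :=
  bary A B C ((1 - m) * ((1 - j) * a)) ((1 - m) * j + m * a).

Definition route (A B C : point) : R -> point :=
  polyline (bary A B C (1 / 3) (1 / 3))
    [bary A B C (1 / 2) (1 / 2); bary A B C 1 0; bary A B C a 0;
     turn1 A B C; turn2 A B C; bary A B C a 0; bary A B C 0 0].

(** The lengths |Q1J1|, |J1P1|, |P1Q1|, written in coordinates so that the same numbers serve both
    routes. *)
Definition leg1 : R := bary_dist a 0 ((1 - j) * a) j.
Definition leg2 : R :=
  bary_dist ((1 - j) * a) j ((1 - m) * ((1 - j) * a)) ((1 - m) * j + m * a).
Definition leg3 : R :=
  bary_dist ((1 - m) * ((1 - j) * a)) ((1 - m) * j + m * a) a 0.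

(** [base_time], [detour_start] and [detour_end] are the times at B, at Q1 before the detour, and at
    Q1 after it. *)
Definition base_time : R := sqrt 3 / 6 + 1 / 2.
Definition detour_start : R := base_time + (1 - a).
Definition detour_end : R := detour_start + leg1 + leg2 + leg3.

Lemma inradius : bary_dist (1 / 3) (1 / 3) (1 / 2) (1 / 2) = sqrt 3 / 6.
Proof.
  apply bary_dist_eq; [pose proof (sqrt_pos 3); lra |].
  unfold Rdiv; rewrite Rpow_mult_distr, pow2_sqrt; lra.
Qed.

Lemma legs_ge_0 : 0 < sqrt 3 / 6 /\ 0 <= leg1 /\ 0 <= leg2 /\ 0 <= leg3.
Proof.
  repeat split; try apply bary_dist_ge_0.
  assert (0 < sqrt 3) by (apply sqrt_lt_R0; lra); lra.
Qed.

Section Positions.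

Variables A B C : point.
Hypothesis ABC : equilateral A B C.

Lemma leg_lengths :
  cdist (bary A B C (1 / 3) (1 / 3)) (bary A B C (1 / 2) (1 / 2)) = sqrt 3 / 6 /\
  cdist (bary A B C (1 / 2) (1 / 2)) (bary A B C 1 0) = 1 / 2 /\
  cdist (bary A B C 1 0) (bary A B C a 0) = 1 - a /\
  cdist (bary A B C a 0) (turn1 A B C) = leg1 /\
  cdist (turn1 A B C) (turn2 A B C) = leg2 /\
  cdist (turn2 A B C) (bary A B C a 0) = leg3 /\
  cdist (bary A B C a 0) (bary A B C 0 0) = a.
Proof.
  unfold turn1, turn2; rewrite !cdist_bary by exact ABC.
  repeat split; try reflexivity; [apply inradius | | |];
    apply bary_dist_eq; try lra; ring.
Qed.

(** The strict bound on [t] keeps the point off the perimeter, hence away from every exit. *)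
Lemma route_OM (t : R) :
  0 <= t < sqrt 3 / 6 -> exists b, 1 / 3 <= b < 1 / 2 /\ route A B C t = bary A B C b b.
Proof.
  destruct leg_lengths as (L & _); intros Ht; unfold route.
  destruct (leg_parameter (sqrt 3 / 6) t) as (l & Hl & ->); [lra |].
  rewrite (polyline_leg _ _ _ _ _ L), bary_towards by exact Hl.
  exists (1 / 3 + l * (1 / 2 - 1 / 3)); split; [| reflexivity].
  assert (l < 1) by nra; lra.
Qed.

Lemma route_from_M (s : R) :
  0 <= s ->
  route A B C (sqrt 3 / 6 + s) =
  polyline (bary A B C (1 / 2) (1 / 2))
    [bary A B C 1 0; bary A B C a 0; turn1 A B C; turn2 A B C; bary A B C a 0; bary A B C 0 0] s.
Proof.
  destruct leg_lengths as (L & _); intros Hs; unfold route.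
  now apply polyline_skip.
Qed.

Lemma route_from_B (s : R) :
  0 <= s ->
  route A B C (base_time + s) =
  polyline (bary A B C 1 0)
    [bary A B C a 0; turn1 A B C; turn2 A B C; bary A B C a 0; bary A B C 0 0] s.
Proof.
  destruct leg_lengths as (_ & L & _); intros Hs; unfold base_time.
  rewrite Rplus_assoc, route_from_M by lra; now apply polyline_skip.
Qed.

Lemma route_from_detour (s : R) :
  0 <= s ->
  route A B C (detour_start + s) =
  polyline (bary A B C a 0) [turn1 A B C; turn2 A B C; bary A B C a 0; bary A B C 0 0] s.
Proof.
  destruct leg_lengths as (_ & _ & L & _); intros Hs; unfold detour_start.
  rewrite Rplus_assoc, route_from_B by lra; now apply polyline_skip.
Qed.

Lemma route_MB (e : R) :
  0 <= e <= 1 / 2 -> route A B C (sqrt 3 / 6 + e) = bary A B C (1 / 2 + e) (1 / 2 - e).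
Proof.
  destruct leg_lengths as (_ & L & _); intros He; rewrite route_from_M by lra.
  replace e with (2 * e * (1 / 2)) at 1 by lra.
  rewrite (polyline_leg _ _ _ _ _ L), bary_towards by lra; f_equal; lra.
Qed.

Lemma route_BQ (e : R) :
  0 <= e <= 1 - a -> route A B C (base_time + e) = bary A B C (1 - e) 0.
Proof.
  destruct leg_lengths as (_ & _ & L & _); intros He; rewrite route_from_B by lra.
  destruct (leg_parameter (1 - a) e) as (l & Hl & ->); [lra |].
  rewrite (polyline_leg _ _ _ _ _ L), bary_towards by lra; f_equal; lra.
Qed.

Lemma route_QJ (l : R) :
  0 <= l <= 1 ->
  route A B C (detour_start + l * leg1) = towards (bary A B C a 0) (turn1 A B C) l.
Proof.
  destruct leg_lengths as (_ & _ & _ & L & _); destruct legs_ge_0 as (_ & ? & _); intros Hl.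
  rewrite route_from_detour by nra; now apply polyline_leg.
Qed.

Lemma route_JP (l : R) :
  0 <= l <= 1 ->
  route A B C (detour_start + leg1 + l * leg2) = towards (turn1 A B C) (turn2 A B C) l.
Proof.
  destruct leg_lengths as (_ & _ & _ & L & L' & _).
  destruct legs_ge_0 as (_ & ? & ? & _); intros Hl.
  rewrite Rplus_assoc, route_from_detour, (polyline_skip _ _ _ _ _ L) by nra.
  now apply polyline_leg.
Qed.

Lemma route_QA (e : R) :
  0 <= e <= a -> route A B C (detour_end + e) = bary A B C (a - e) 0.
Proof.
  destruct leg_lengths as (_ & _ & _ & L1 & L2 & L3 & L4).
  destruct legs_ge_0 as (_ & ? & ? & ?); intros He; unfold detour_end.
  rewrite !Rplus_assoc, route_from_detour, (polyline_skip _ _ _ _ _ L1),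
    (polyline_skip _ _ _ _ _ L2), (polyline_skip _ _ _ _ _ L3) by lra.
  destruct (leg_parameter a e) as (l & Hl & ->); [lra |].
  rewrite (polyline_leg _ _ _ _ _ L4), bary_towards by lra; f_equal; lra.
Qed.

(** The part of the angle at A beyond the line Q1Q2 is convex and contains M, B, Q1, J1 and P1. So
    no point of Q1A other than Q1 is met before [detour_end]. *)
Lemma route_before_detour_end (t : R) :
  sqrt 3 / 6 <= t <= detour_end ->
  exists b g, 0 <= b /\ 0 <= g /\ a <= b + g /\ route A B C t = bary A B C b g.
Proof.
  set (D := fun P => exists b g, 0 <= b /\ 0 <= g /\ a <= b + g /\ P = bary A B C b g).
  assert (HD : forall P Q l, D P -> D Q -> 0 <= l <= 1 -> D (towards P Q l)).
  { intros P Q l (b & g & Hb & Hg & Hs & ->) (b' & g' & Hb' & Hg' & Hs' & ->) Hl.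
    exists (b + l * (b' - b)), (g + l * (g' - g)).
    rewrite bary_towards; repeat split; nra. }
  assert (D1 : D (bary A B C (1 / 2) (1 / 2))) by (exists (1 / 2), (1 / 2); repeat split; lra).
  assert (D2 : D (bary A B C 1 0)) by (exists 1, 0; repeat split; lra).
  assert (D3 : D (bary A B C a 0)) by (exists a, 0; repeat split; lra).
  assert (D4 : D (turn1 A B C)) by (eexists _, _; repeat split; nra).
  assert (D5 : D (turn2 A B C)).
  (* P1 lies between J1 and Q2, both in the region. *)
  { assert (D6 : D (bary A B C 0 a)) by (exists 0, a; repeat split; lra).
    assert (D7 := HD _ _ m D4 D6 Hm); unfold turn1 in D7; rewrite bary_towards in D7.
    unfold turn2; replace ((1 - m) * ((1 - j) * a)) with ((1 - j) * a + m * (0 - (1 - j) * a)) by ring.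
    now replace ((1 - m) * j + m * a) with (j + m * (a - j)) by ring. }
  destruct leg_lengths as (_ & L1 & L2 & L3 & L4 & L5 & _); intros Ht.
  change (D (route A B C t)).
  replace t with (sqrt 3 / 6 + (t - sqrt 3 / 6)) by ring; rewrite route_from_M by lra.
  assert (Hs : t - sqrt 3 / 6 <= 1 / 2 + (1 - a) + leg1 + leg2 + leg3)
    by (unfold detour_end, detour_start, base_time in Ht; lra).
  assert (Hs0 : 0 <= t - sqrt 3 / 6) by lra.
  set (s := t - sqrt 3 / 6) in *; clearbody s; clear Ht.
  edestruct polyline_inv as [(l & Hl & _ & ->) | (s1 & Hs1 & E1 & ->)]; [exact Hs0 | now apply HD |].
  edestruct polyline_inv as [(l & Hl & _ & ->) | (s2 & Hs2 & E2 & ->)]; [apply Rlt_le, Hs1 | now apply HD |].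
  edestruct polyline_inv as [(l & Hl & _ & ->) | (s3 & Hs3 & E3 & ->)]; [apply Rlt_le, Hs2 | now apply HD |].
  edestruct polyline_inv as [(l & Hl & _ & ->) | (s4 & Hs4 & E4 & ->)]; [apply Rlt_le, Hs3 | now apply HD |].
  edestruct polyline_inv as [(l & Hl & _ & ->) | (s5 & Hs5 & E5 & ->)]; [apply Rlt_le, Hs4 | now apply HD |].
  (* After five full legs the time exceeds [detour_end]. *)
  lra.
Qed.

End Positions.

(** * When each exit is first found *)

Section FirstVisits.

Variables A B C : point.
Hypothesis ABC : equilateral A B C.
Let ACB : equilateral A C B := equilateral_swap A B C ABC.

Lemma first_visit_MB (e : R) :
  0 <= e <= 1 / 2 ->
  first_visit (route A B C) (route A C B) (bary A B C (1 / 2 + e) (1 / 2 - e)) (sqrt 3 / 6 + e).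
Proof.
  destruct legs_ge_0 as (Hy & _); intros He.
  split; [lra | split; [now apply route_MB |]]; intros s Hs.
  destruct (Rlt_le_dec s (sqrt 3 / 6)) as [L | L].
  - destruct (route_OM A B C ABC s) as (b & Hb & ->); [lra |].
    destruct (route_OM A C B ACB s) as (b' & Hb' & ->); [lra |].
    rewrite (bary_swap A B C); split; intros E; apply bary_inj in E; auto; lra.
  - replace s with (sqrt 3 / 6 + (s - sqrt 3 / 6)) by ring.
    rewrite !route_MB by (auto; lra).
    rewrite (bary_swap A B C); split; intros E; apply bary_inj in E; auto; lra.
Qed.

Lemma first_visit_BQ (e : R) :
  0 <= e <= 1 - a ->
  first_visit (route A B C) (route A C B) (bary A B C (1 - e) 0) (base_time + e).
Proof.
  destruct legs_ge_0 as (Hy & _); intros He; unfold base_time.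
  split; [lra | split; [now apply route_BQ |]]; intros s Hs.
  destruct (Rlt_le_dec s (sqrt 3 / 6)) as [L | L];
    [| destruct (Rlt_le_dec s (sqrt 3 / 6 + 1 / 2)) as [L' | L']].
  - destruct (route_OM A B C ABC s) as (b & Hb & ->); [lra |].
    destruct (route_OM A C B ACB s) as (b' & Hb' & ->); [lra |].
    rewrite (bary_swap A B C); split; intros E; apply bary_inj in E; auto; lra.
  - replace s with (sqrt 3 / 6 + (s - sqrt 3 / 6)) by ring.
    rewrite !route_MB by (auto; lra).
    rewrite (bary_swap A B C); split; intros E; apply bary_inj in E; auto; lra.
  - replace s with (base_time + (s - base_time)) by ring; unfold base_time.
    rewrite !route_BQ by (auto; unfold base_time; lra).
    rewrite (bary_swap A B C); split; intros E; apply bary_inj in E; auto; unfold base_time in E; lra.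
Qed.

(** On OM the two coordinates are positive, up to [detour_end] their sum is at least [a], and
    afterwards both agents are closer to Q1 or Q2 than the exit is to Q1. *)
Lemma first_visit_QA (e : R) :
  0 < e <= a ->
  first_visit (route A B C) (route A C B) (bary A B C (a - e) 0) (detour_end + e).
Proof.
  destruct legs_ge_0 as (Hy & H1 & H2 & H3); intros He.
  assert (Hend : sqrt 3 / 6 + 1 / 2 <= detour_end) by (unfold detour_end, detour_start, base_time; lra).
  split; [lra | split; [apply route_QA; auto; lra |]]; intros s Hs.
  destruct (Rlt_le_dec s (sqrt 3 / 6)) as [L | L];
    [| destruct (Rle_lt_dec s detour_end) as [L' | L']].
  - destruct (route_OM A B C ABC s) as (b & Hb & ->); [lra |].
    destruct (route_OM A C B ACB s) as (b' & Hb' & ->); [lra |].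
    rewrite (bary_swap A B C); split; intros E; apply bary_inj in E; auto; lra.
  - destruct (route_before_detour_end A B C ABC s) as (b & g & Hb & Hg & Hs' & ->); [lra |].
    destruct (route_before_detour_end A C B ACB s) as (b' & g' & Hb' & Hg' & Hs'' & ->); [lra |].
    rewrite (bary_swap A B C); split; intros E; apply bary_inj in E; auto; lra.
  - replace s with (detour_end + (s - detour_end)) by ring.
    rewrite !route_QA by (auto; lra).
    rewrite (bary_swap A B C); split; intros E; apply bary_inj in E; auto; lra.
Qed.

End FirstVisits.

(** * Bounds on the evacuation time for the exits on each segment *)

Section Detour.

(** [z] is |Q1Z|; [HJ], [HP] and [HZ] are the defining equations of J1, P1 and Z. *)
Variables r z : R.
Hypothesis Hr : 0 < r < a.
Hypothesis Hz : 0 <= z <= a.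
Hypothesis HJ : 1 - a + leg1 + r = bary_dist 0 1 ((1 - j) * a) j.
Hypothesis HP :
  leg1 + leg2 + r = bary_dist 0 a ((1 - m) * ((1 - j) * a)) ((1 - m) * j + m * a).
Hypothesis HZ : z + r = bary_dist 0 a (a - z) 0.

(** These two times are t1 and t2; by [HZ], the summand [z + r] is |ZQ2|. *)
Definition time_exit_B : R := detour_start + bary_dist a 0 0 1.
Definition time_exit_Q : R := detour_end + z + (z + r).

Section Exits.

Variables A B C : point.
Hypothesis ABC : equilateral A B C.
Let ACB : equilateral A C B := equilateral_swap A B C ABC.

Lemma turn1_towards (A' B' C' : point) :
  turn1 A' B' C' = towards (bary A' B' C' a 0) (bary A' B' C' 0 1) j.
Proof. unfold turn1; rewrite bary_towards; f_equal; ring. Qed.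

Lemma leg1_eq : leg1 = j * bary_dist a 0 0 1.
Proof.
  destruct (leg_lengths A B C ABC) as (_ & _ & _ & L & _).
  rewrite <- L, turn1_towards, cdist_towards_l, cdist_bary; auto; lra.
Qed.

(** J1 cuts Q1C into pieces [j] and [1 - j]. With [leg1_eq], walking from Q2 to J2 and then to B
    takes |Q1C|, so a message received at J2 about an exit at B gives exactly [time_exit_B]. *)
Lemma B_turn1_eq : 1 - a + leg1 + r = (1 - j) * bary_dist a 0 0 1.
Proof.
  rewrite HJ, bary_dist_sym, <- (cdist_bary A B C) by auto.
  change (bary A B C ((1 - j) * a) j) with (turn1 A B C).
  rewrite turn1_towards, cdist_towards_r, cdist_bary; auto; lra.
Qed.

Lemma cdist_B_turn1 : cdist (bary A B C 1 0) (turn1 A C B) = 1 - a + leg1 + r.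
Proof.
  unfold turn1; rewrite (bary_swap A B C), cdist_bary, bary_dist_swap by auto; auto.
Qed.

Lemma cdist_M_turn1 : cdist (bary A B C (1 / 2) (1 / 2)) (turn1 A C B) <= 1 - a + leg1 + r.
Proof.
  destruct legs_ge_0 as (_ & Hleg & _).
  (* |Q1J1| is less than |J1C|. The squared distances from J2 to B and to M differ by
     [(1 / 2 + (1 - j) * a - j) / 2], which is then nonnegative. *)
  assert (Hj2 : j <= 1 / 2).
  { pose proof leg1_eq; pose proof B_turn1_eq; nra. }
  rewrite <- cdist_B_turn1; unfold turn1; rewrite (bary_swap A B C), !cdist_bary by auto.
  apply sqrt_le_1_alt; nra.
Qed.

Lemma exit_MB_le (e : R) :
  0 <= e <= 1 / 2 ->
  Rbar_le (evacuation_time r (route A B C) (route A C B) (bary A B C (1 / 2 + e) (1 / 2 - e)))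
    time_exit_B.
Proof.
  intros He; destruct legs_ge_0 as (Hy & H1 & _).
  pose proof (first_visit_MB A B C ABC e He) as Hfirst.
  replace (bary A B C (1 / 2 + e) (1 / 2 - e))
    with (towards (bary A B C (1 / 2) (1 / 2)) (bary A B C 1 0) (2 * e)) in *
    by (rewrite bary_towards; f_equal; field).
  pose proof cdist_B_turn1; pose proof cdist_M_turn1; pose proof leg1_eq; pose proof B_turn1_eq.
  assert (Hstart : sqrt 3 / 6 + 1 / 2 <= detour_start) by (unfold detour_start, base_time; lra).
  apply (evacuation_time_le_chord r _ _ _ _ (turn1 A C B) (turn1 A C B)
    (sqrt 3 / 6) (sqrt 3 / 6 + 1 / 2) (detour_start + leg1) (detour_start + leg1));
    unfold time_exit_B, detour_start, base_time in *; try lra.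
  - apply polyline_speed.
  - now replace ((1 - 2 * e) * (sqrt 3 / 6) + 2 * e * (sqrt 3 / 6 + 1 / 2))
      with (sqrt 3 / 6 + e) by field.
  - rewrite towards_self, <- (towards_1 (bary A C B a 0) (turn1 A C B)), <- (route_QJ A C B) by (auto; lra).
    f_equal; unfold detour_start, base_time; ring.
Qed.

(** The path from P1 through Q1 and Z to Q2 is at least |P1Q2| long. Hence an exit at Q1, announced
    at P2, is evacuated by [time_exit_Q]. *)
Lemma cdist_turn2_Q :
  bary_dist 0 a ((1 - m) * ((1 - j) * a)) ((1 - m) * j + m * a) <= leg3 + z + (z + r).
Proof.
  destruct (leg_lengths A B C ABC) as (_ & _ & _ & _ & _ & L & _).
  rewrite <- (cdist_bary A B C), cdist_sym by auto.
  change (bary A B C ((1 - m) * ((1 - j) * a)) ((1 - m) * j + m * a)) with (turn2 A B C).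
  pose proof (cdist_triangle (turn2 A B C) (bary A B C a 0) (bary A B C 0 a)) as T.
  pose proof (cdist_triangle (bary A B C a 0) (bary A B C (a - z) 0) (bary A B C 0 a)) as T'.
  rewrite (cdist_sym _ (bary A B C 0 a)) in T'.
  rewrite (cdist_sym (bary A B C (a - z) 0)) in T'.
  rewrite L in T; rewrite !(cdist_bary A B C) in T' by auto.
  rewrite <- HZ, <- (cdist_bary A B C), cdist_sym in T' by auto.
  rewrite (bary_dist_eq a 0 (a - z) 0 z) in T' by (try ring; lra); lra.
Qed.

Lemma exit_BQ_le (e : R) :
  0 <= e <= 1 - a ->
  Rbar_le (evacuation_time r (route A B C) (route A C B) (bary A B C (1 - e) 0))
    (Rmax time_exit_B time_exit_Q).
Proof.
  intros He; destruct legs_ge_0 as (Hy & H1 & H2 & H3).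
  pose proof (first_visit_BQ A B C ABC e He) as Hfirst.
  destruct (leg_parameter (1 - a) e He) as (l & Hl & ->).
  replace (bary A B C (1 - l * (1 - a)) 0)
    with (towards (bary A B C 1 0) (bary A B C a 0) l) in *
    by (rewrite bary_towards; f_equal; ring).
  pose proof (Rmax_l time_exit_B time_exit_Q); pose proof (Rmax_r time_exit_B time_exit_Q).
  pose proof cdist_B_turn1; pose proof leg1_eq; pose proof B_turn1_eq; pose proof cdist_turn2_Q.
  assert (D : cdist (bary A B C a 0) (turn2 A C B) = leg1 + leg2 + r)
    by (unfold turn2; rewrite (bary_swap A B C), cdist_bary, bary_dist_swap by auto; auto).
  (* The end B with J2 is bounded by the first term of the maximum, the end Q1 with P2 by the
     second. *)
  apply (evacuation_time_le_chord r _ _ _ _ (turn1 A C B) (turn2 A C B)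
    base_time detour_start (detour_start + leg1) (detour_start + leg1 + leg2));
    unfold time_exit_B, time_exit_Q, detour_end, detour_start in *; try lra.
  - apply polyline_speed.
  - now replace ((1 - l) * base_time + l * (base_time + (1 - a)))
      with (base_time + l * (1 - a)) by ring.
  - rewrite <- (route_JP A C B) by auto.
    f_equal; unfold detour_start; ring.
Qed.

Lemma exit_QA_le (e : R) :
  0 < e <= a ->
  Rbar_le (evacuation_time r (route A B C) (route A C B) (bary A B C (a - e) 0)) time_exit_Q.
Proof.
  intros He; pose proof (first_visit_QA A B C ABC e He) as Hfirst.
  destruct (leg_parameter a e) as (l & Hl & ->); [lra |].
  replace (bary A B C (a - l * a) 0)
    with (towards (bary A B C a 0) (bary A B C 0 0) l) in *
    by (rewrite bary_towards; f_equal; ring).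
  assert (D : cdist (bary A B C a 0) (bary A C B (a - z) 0) = z + r)
    by (rewrite (bary_swap A B C), cdist_bary, bary_dist_swap by auto; auto).
  assert (D' : cdist (bary A B C 0 0) (bary A C B 0 0) = 0)
    by (rewrite (bary_swap A B C), cdist_refl; auto).
  (* The triangle AQ1Q2 is equilateral, so [a = |Q1Q2| <= |Q1Z| + |ZQ2|]; this handles the exit
     A. *)
  assert (T : a <= z + (z + r)).
  { pose proof (cdist_triangle (bary A B C 0 a) (bary A B C (a - z) 0) (bary A B C a 0)) as T.
    rewrite !(cdist_bary A B C), <- HZ in T by auto.
    rewrite (bary_dist_eq (a - z) 0 a 0 z), (bary_dist_eq 0 a a 0 a) in T by (try ring; lra); lra. }
  (* The chord's ends enter only through inequalities, so Q1 may carry the time [detour_end]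
     although it is found earlier. *)
  apply (evacuation_time_le_chord r _ _ _ _ (bary A C B (a - z) 0) (bary A C B 0 0)
    detour_end (detour_end + a) (detour_end + z) (detour_end + a));
    unfold time_exit_Q; try lra.
  - apply polyline_speed.
  - now replace ((1 - l) * detour_end + l * (detour_end + a)) with (detour_end + l * a) by ring.
  - replace ((1 - l) * (detour_end + z) + l * (detour_end + a))
      with (detour_end + ((1 - l) * z + l * a)) by ring.
    rewrite (route_QA A C B), bary_towards by (auto; nra); f_equal; ring.
Qed.

Lemma exit_AB_le (b : R) :
  0 <= b <= 1 ->
  Rbar_le (evacuation_time r (route A B C) (route A C B) (bary A B C b 0))
    (Rmax time_exit_B time_exit_Q).
Proof.
  intros Hb; destruct (Rle_lt_dec a b) as [L | L].
  - replace b with (1 - (1 - b)) by ring; apply exit_BQ_le; lra.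
  - replace b with (a - (a - b)) by ring.
    apply Rbar_le_trans with time_exit_Q; [apply exit_QA_le; lra | apply Rmax_r].
Qed.

Lemma exit_B_ge :
  Rbar_le time_exit_B (evacuation_time r (route A B C) (route A C B) (bary A B C 1 0)).
Proof.
  destruct legs_ge_0 as (_ & H1 & _).
  pose proof leg1_eq as EJ; pose proof B_turn1_eq as EB.
  set (len := bary_dist a 0 0 1) in *.
  assert (EY : route A C B (detour_start + leg1) = turn1 A C B).
  { rewrite <- (towards_1 (bary A C B a 0)), <- (route_QJ A C B) by (auto; lra); f_equal; ring. }
  replace time_exit_B with
    (detour_start + leg1 + cdist (bary A B C 1 0) (route A C B (detour_start + leg1)))
    by (rewrite EY, cdist_B_turn1; unfold time_exit_B; fold len; lra).
  apply (evacuation_time_ge r _ _ _ base_time);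
    try (unfold detour_start, base_time; lra).
  - apply polyline_speed.
  - pose proof (first_visit_BQ A B C ABC 0) as F.
    rewrite Rminus_0_r, Rplus_0_r in F; apply F; lra.
  - replace base_time with (base_time + 0) by ring.
    rewrite (route_BQ A C B), (bary_swap A B C) by (auto; lra); intros E.
    apply bary_inj in E; auto; lra.
  - intros s Hs; unfold detour_start in Hs.
    assert (Hlen : len ^ 2 = 1 - a * (1 - a)) by (unfold len; rewrite bary_dist_sqr; ring).
    destruct (Rlt_le_dec s detour_start) as [L | L]; unfold detour_start in L.
    + replace s with (base_time + (s - base_time)) at 2 by ring.
      rewrite (route_BQ A C B), (bary_swap A B C), cdist_bary by (auto; lra).
      set (e := s - base_time) in *; assert (He : 0 <= e < 1 - a) by (unfold e; lra).
      enough (r + e < bary_dist 1 0 0 (1 - e)) by lra.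
      (* Squared, the goal reads [r ^ 2 + (2 * r + 1) * e < 1], and [Hge] is its weak form at
         [e = 1 - a]. *)
      assert (Hge : 1 - a + r <= len) by nra.
      apply Rsqr_incrst_0; [| lra | apply bary_dist_ge_0].
      rewrite !Rsqr_pow2, bary_dist_sqr; nra.
    + destruct (leg_parameter leg1 (s - detour_start)) as (l & Hl & El);
        [unfold detour_start; lra |].
      replace s with (detour_start + l * leg1) by lra.
      rewrite (route_QJ A C B), turn1_towards by auto.
      (* On Q2J2 the partner heads straight for B, so its distance to B falls as fast as time grows;
         equality occurs at J2. *)
      replace (towards _ _ l) with (towards (bary A C B a 0) (bary A C B 0 1) (l * j))
        by (unfold towards; apply injective_projections; simpl; ring).
      replace (bary A B C 1 0) with (bary A C B 0 1) by apply bary_swap.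
      rewrite cdist_sym, cdist_towards_r, cdist_bary by (auto; nra); fold len.
      unfold detour_start in *; nra.
Qed.

(* While [e < z], the mirrored agent, at distance [e] past [Q2], is out of reach
   of an agent that left [Q1] when it left [Q2]; an exit at distance [d] past
   [Q1] shifts both sides by at most [d]. *)
Lemma exit_QA_ge (d : R) :
  0 < d <= z ->
  Rbar_le (time_exit_Q - d)
    (evacuation_time r (route A B C) (route A C B) (bary A B C (a - d) 0)).
Proof.
  intros Hd.
  pose proof (bary_dist_sqr 0 a (a - z) 0) as SZ; rewrite <- HZ in SZ.
  (* [SZ] amounts to [r ^ 2 + (2 * r + a) * z = a ^ 2]. The left side increases with [z], which also
     gives the strict inequality for [e < z] at the end. *)
  assert (Hza : z < a) by nra.
  assert (EQ : forall e, 0 <= e <= a ->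
    bary_dist a 0 0 (a - e) - d <= cdist (bary A B C (a - d) 0) (route A C B (detour_end + e))).
  { intros e He; rewrite (route_QA A C B), (bary_swap A B C) by (auto; lra).
    pose proof (cdist_triangle (bary A B C a 0) (bary A B C (a - d) 0) (bary A B C 0 (a - e))) as T.
    rewrite (cdist_bary A B C a 0 0), (cdist_bary A B C a 0 (a - d)), (bary_dist_eq a 0 (a - d) 0 d)
      in T by (auto; try ring; lra); lra. }
  apply Rbar_le_trans with
    (detour_end + z + cdist (bary A B C (a - d) 0) (route A C B (detour_end + z))).
  - simpl; pose proof (EQ z Hz) as E; rewrite bary_dist_swap, <- HZ in E.
    unfold time_exit_Q; lra.
  - apply (evacuation_time_ge r _ _ _ (detour_end + d)); try lra.
    + apply polyline_speed.
    + apply first_visit_QA; auto; lra.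
    + rewrite (route_QA A C B), (bary_swap A B C) by (auto; lra); intros E.
      apply bary_inj in E; auto; lra.
    + intros s Hs; set (e := s - detour_end).
      replace s with (detour_end + e) by (unfold e; ring).
      assert (He : 0 <= e < z) by (unfold e; lra).
      pose proof (EQ e) as E.
      enough (r + e < bary_dist a 0 0 (a - e)) by lra.
      apply Rsqr_incrst_0; [| lra | apply bary_dist_ge_0].
      rewrite !Rsqr_pow2, bary_dist_sqr; nra.
Qed.

End Exits.
End Detour.
End Route.

(** * The worst case *)

Lemma mirror_bary (A B C : point) (b g : R) :
  equilateral A B C -> mirror A (midpoint B C) (bary A B C b g) = bary A B C g b.
Proof.
  intros (HAB & HBC & HCA).
  pose proof (cdist_sqr A B) as E1; pose proof (cdist_sqr B C) as E2; pose proof (cdist_sqr C A) as E3.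
  rewrite HAB in E1; rewrite HBC in E2; rewrite HCA in E3.
  set (w := (midpoint B C - A)%C).
  assert (Ew : w = (fst ((B - A) + (C - A))%C / 2, snd ((B - A) + (C - A))%C / 2)).
  { unfold w, midpoint; apply injective_projections; simpl; field. }
  assert (Hw : Cconj w <> RtoC 0).
  { rewrite Ew; intros E; injection E as X1 X2; simpl in *.
    (* The vector [(B - A) + (C - A)] has squared length 1 + 1 + 1. *)
    assert (N : (fst B + fst C - 2 * fst A) ^ 2 + (snd B + snd C - 2 * snd A) ^ 2 = 3) by lra.
    replace (fst B + fst C - 2 * fst A) with 0 in N by lra.
    replace (snd B + snd C - 2 * snd A) with 0 in N by lra; lra. }
  assert (Hw' : w <> RtoC 0).
  { intros E; apply Hw; rewrite E; apply injective_projections; simpl; ring. }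
  unfold mirror; fold w; rewrite Cdiv_conj by exact Hw'.
  (* With [u = B - A] and [v = C - A], [|u| = |v|] gives
     [(u + v) * conj u = v * conj (u + v)]. *)
  assert (K : (w * Cconj (bary A B C b g - A) = (bary A B C g b - A) * Cconj w)%C).
  { rewrite Ew; unfold bary; destruct A as [a1 a2], B as [b1 b2], C as [c1 c2]; simpl in *.
    apply injective_projections; simpl; [apply Rminus_diag_uniq | field].
    transitivity ((b - g) / 2 * (((b1 - a1) ^ 2 + (b2 - a2) ^ 2) - ((c1 - a1) ^ 2 + (c2 - a2) ^ 2))).
    - field.
    - replace (((b1 - a1) ^ 2 + (b2 - a2) ^ 2) - ((c1 - a1) ^ 2 + (c2 - a2) ^ 2)) with 0 by lra; ring. }
  unfold Cdiv; rewrite Cmult_assoc, K, <- Cmult_assoc, Cinv_r, Cmult_1_r by exact Hw.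
  apply injective_projections; simpl; ring.
Qed.

Lemma midpoint_bary (A B C : point) : midpoint B C = bary A B C (1 / 2) (1 / 2).
Proof. unfold midpoint, bary; apply injective_projections; simpl; field. Qed.

Lemma centroid_bary (A B C : point) : centroid A B C = bary A B C (1 / 3) (1 / 3).
Proof. unfold centroid, bary; apply injective_projections; simpl; field. Qed.

Lemma vertices_bary (A B C : point) :
  A = bary A B C 0 0 /\ B = bary A B C 1 0 /\ C = bary A B C 0 1.
Proof. unfold bary; repeat split; apply injective_projections; simpl; ring. Qed.

Theorem theorem3p2 (r : R) (A B C Q1 Q2 J1 P1 Z : point)
  (hr : 0 < r < 1)
  (hAB : cdist A B = 1) (hBC : cdist B C = 1) (hCA : cdist C A = 1)
  (hQ1 : on_segment A B Q1) (hAQ1 : r < cdist A Q1)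
  (hQ2 : Q2 = mirror A (midpoint B C) Q1)
  (hJ1 : on_segment Q1 C J1)
  (hJ1eq : cdist B Q1 + cdist Q1 J1 = cdist C J1 - r)
  (hP1 : on_segment J1 Q2 P1)
  (hP1eq : cdist Q1 J1 + cdist J1 P1 = cdist Q2 P1 - r)
  (hZ : on_segment Q1 A Z)
  (hZeq : cdist Q1 Z + r = cdist Q2 Z) :
  let y := sqrt 3 / 6 in
  let t1 := y + 1 / 2 + cdist B Q1 + cdist Q1 C in
  let t2 := y + 1 / 2 + cdist B Q1 + cdist Q1 J1 + cdist J1 P1 + cdist P1 Q1
            + cdist Q1 Z + cdist Z Q2 in
  E_1Detour r A B C Q1 J1 P1 = Finite (Rmax t1 t2).
Proof.
  intros y t1 t2.
  assert (ABC : equilateral A B C) by (repeat split; auto).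
  pose proof (equilateral_swap A B C ABC) as ACB.
  destruct (vertices_bary A B C) as (EA & EB & EC).
  destruct hQ1 as (a & Ha & EQ1).
  replace (A + RtoC a * (B - A))%C with (bary A B C a 0) in EQ1
    by (unfold bary; apply injective_projections; simpl; ring).
  rewrite EQ1, mirror_bary in hQ2 by exact ABC.
  destruct hJ1 as (j & Hj & EJ1).
  replace (Q1 + RtoC j * (C - Q1))%C with (turn1 a j A B C) in EJ1
    by (rewrite EQ1; unfold turn1, bary; apply injective_projections; simpl; ring).
  destruct hP1 as (m & Hm & EP1).
  replace (J1 + RtoC m * (Q2 - J1))%C with (turn2 a j m A B C) in EP1
    by (rewrite EJ1, hQ2; unfold turn1, turn2, bary; apply injective_projections; simpl; ring).
  (* [z'] is a fraction of Q1A; [z] is the length |Q1Z|. *)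
  destruct hZ as (z' & Hz' & EZ); set (z := z' * a) in *.
  assert (Hz : 0 <= z <= a) by (unfold z; nra).
  replace (Q1 + RtoC z' * (A - Q1))%C with (bary A B C (a - z) 0) in EZ
    by (rewrite EQ1; unfold bary, z; apply injective_projections; simpl; ring).
  assert (DAQ : cdist A Q1 = a).
  { rewrite EA, EQ1, cdist_bary by exact ABC; apply bary_dist_eq; [lra | ring]. }
  assert (DBQ : cdist B Q1 = 1 - a).
  { rewrite EB, EQ1, cdist_bary by exact ABC; apply bary_dist_eq; [lra | ring]. }
  assert (DQZ : cdist Q1 Z = z).
  { rewrite EQ1, EZ, cdist_bary by exact ABC; apply bary_dist_eq; [lra | ring]. }
  destruct (leg_lengths a j m ltac:(lra) A B C ABC) as (_ & _ & _ & L1 & L2 & L3 & _).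
  rewrite <- EQ1, <- EJ1 in L1; rewrite <- EJ1, <- EP1 in L2; rewrite <- EP1, <- EQ1 in L3.
  rewrite DAQ in hAQ1.
  assert (HJ : 1 - a + leg1 a j + r = bary_dist 0 1 ((1 - j) * a) j).
  { rewrite <- (cdist_bary A B C), <- EC by exact ABC.
    fold (turn1 a j A B C); rewrite <- EJ1; lra. }
  assert (HP : leg1 a j + leg2 a j m + r
    = bary_dist 0 a ((1 - m) * ((1 - j) * a)) ((1 - m) * j + m * a)).
  { rewrite <- (cdist_bary A B C), <- hQ2 by exact ABC.
    fold (turn2 a j m A B C); rewrite <- EP1; lra. }
  assert (HZ : z + r = bary_dist 0 a (a - z) 0).
  { rewrite <- (cdist_bary A B C), <- hQ2, <- EZ by exact ABC; lra. }
  assert (Et1 : t1 = time_exit_B a).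
  { unfold t1, time_exit_B, detour_start, base_time, y.
    rewrite <- (cdist_bary A B C), <- EQ1, <- EC by exact ABC; lra. }
  assert (Et2 : t2 = time_exit_Q a j m r z).
  { unfold t2, time_exit_Q, detour_end, detour_start, base_time, y.
    rewrite (cdist_sym Z); lra. }
  assert (EX : detour_trajectory A B C B Q1 J1 P1 = route a j m A B C).
  { unfold detour_trajectory, route.
    now rewrite (centroid_bary A B C), (midpoint_bary A B C), <- EA, <- EB, <- EQ1, <- EJ1, <- EP1. }
  assert (EY : detour_trajectory A B C C (mirror A (midpoint B C) Q1)
    (mirror A (midpoint B C) J1) (mirror A (midpoint B C) P1) = route a j m A C B).
  { rewrite EQ1, EJ1, EP1; unfold turn1, turn2, detour_trajectory, route.
    rewrite !mirror_bary by exact ABC; unfold turn1, turn2; rewrite !(bary_swap A B C).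
    now rewrite (centroid_bary A B C), (midpoint_bary A B C), <- EA, <- EC. }
  unfold E_1Detour; cbv zeta; rewrite EX, EY, Et1, Et2.
  assert (Hapos : 0 < a <= 1) by lra; assert (Hr : 0 < r < a) by lra.
  pose proof (exit_MB_le a j m Hapos Hj Hm r z Hr Hz HJ) as HMB.
  pose proof (exit_AB_le a j m Hapos Hj Hm r z Hr Hz HJ HP HZ) as HAB.
  apply Rbar_is_lub_unique; split.
  - intros t (P & HP' & ->).
    destruct HP' as [(s & Hs & EP) | [(s & Hs & EP) | (s & Hs & EP)]].
    + replace P with (bary A B C s 0)
        by (rewrite EP; unfold bary; apply injective_projections; simpl; ring).
      now apply HAB.
    + apply Rbar_le_trans with (Finite (time_exit_B a)); [| apply Rmax_l].
      destruct (Rle_lt_dec s (1 / 2)).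
      * replace P with (bary A B C (1 / 2 + (1 / 2 - s)) (1 / 2 - (1 / 2 - s)))
          by (rewrite EP; unfold bary; apply injective_projections; simpl; field).
        apply HMB; auto; lra.
      * replace P with (bary A C B (1 / 2 + (s - 1 / 2)) (1 / 2 - (s - 1 / 2)))
          by (rewrite EP; unfold bary; apply injective_projections; simpl; field).
        rewrite evacuation_time_sym; apply HMB; auto; lra.
    + replace P with (bary A C B (1 - s) 0)
        by (rewrite EP; unfold bary; apply injective_projections; simpl; ring).
      rewrite evacuation_time_sym; apply HAB; auto; lra.
  - intros t Ht.
    assert (HB : Rbar_le (time_exit_B a) t).
    { eapply Rbar_le_trans; [apply (exit_B_ge a j m Hapos Hj Hm r z Hr Hz HJ A B C ABC) |].
      apply Ht; exists (bary A B C 1 0); split; [| reflexivity].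
      left; exists 1; split; [lra | unfold bary; apply injective_projections; simpl; ring]. }
    (* [HZ] squared is [r ^ 2 + (2 * r + a) * z = a ^ 2], and [r < a]. *)
    assert (Hz0 : 0 < z).
    { pose proof (bary_dist_sqr 0 a (a - z) 0) as S; rewrite <- HZ in S; nra. }
    assert (HQ : forall d, 0 < d <= z -> Rbar_le (time_exit_Q a j m r z - d) t).
    { intros d Hd.
      eapply Rbar_le_trans; [apply (exit_QA_ge a j m Hapos Hj Hm r z Hr Hz HZ A B C ABC d Hd) |].
      apply Ht; exists (bary A B C (a - d) 0); split; [| reflexivity].
      left; exists (a - d); split; [lra | unfold bary; apply injective_projections; simpl; ring]. }
    destruct t as [t | |]; [| exact I | exact HB].
    simpl in *; apply Rmax_lub; [exact HB |].
    (* The bound t2 is approached by exits at distance [Rmin eps z] past Q1. *)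
    apply le_epsilon; intros eps Heps.
    pose proof (Rmin_l eps z); pose proof (HQ (Rmin eps z)) as Hmin.
    enough (0 < Rmin eps z <= z) by lra.
    split; [now apply Rmin_pos | apply Rmin_r].
Qed.
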